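(* Let $X$ be an infinite-dimensional complex Banach space, $\lambda\in\mathbb{C}$, $T\in L(X)$, $d\in\mathbb{N}_0$, and let $T-\lambda I$ have TUD for $n\ge d$. Then the following statements are equivalent: (1) $\lambda$ is not an interior point of $\sigma_p(T)$; (2) $\sigma_{\mathcal{B}_+}(T)$ does not cluster at $\lambda$; (3) $\lambda$ is not an interior point of $\sigma_{\mathcal{B}_+}(T)$; (4) $\sigma_{LD}(T)$ does not cluster at $\lambda$; (5) $\lambda$ is not an interior point of $\sigma_{LD}(T)$; (6) $T-\lambda I$ is left Drazin invertible.
   Context: $L(X)$ is the algebra of bounded linear operators on $X$; $N(T)$, $R(T)$ are the null space and range; $\mathbb{N}_0=\{0,1,2,\dots\}$. $\sigma_p(T)$ is the point spectrum. The ascent is $a(T)=\inf\{n\in\mathbb{N}_0:N(T^n)=N(T^{n+1})\}$ ($\inf\emptyset=\infty$). $T$ is upper semi-Browder if $\dim N(T)<\infty$, $R(T)$ is closed and $a(T)<\infty$; $\sigma_{\mathcal{B}_+}(T)$ is the set of $\mu\in\mathbb{C}$ such that $T-\mu I$ is not upper semi-Browder. $T$ is left Drazin invertible if $a(T)<\infty$ and $R(T^{a(T)+1})$ is closed; $\sigma_{LD}(T)$ is the set of $\mu\in\mathbb{C}$ such that $T-\mu I$ is not left Drazin invertible. Let $k_n(T)=\dim (R(T^n)\cap N(T))/(R(T^{n+1})\cap N(T))$. The operator range topology on $R(T^d)$ is given by the norm $\|y\|_d=\inf\{\|x\|:x\in X,\ y=T^dx\}$. $T$ has topological uniform descent (TUD)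 for $n\ge d$ if $k_n(T)=0$ for all $n\ge d$ and $R(T^n)$ is closed in the operator range topology of $R(T^d)$ for all $n\ge d$. A set $K\subset\mathbb{C}$ does not cluster at $\lambda$ if $\lambda$ is not an accumulation point of $K$; interior is taken in $\mathbb{C}$. *)

(* Defs.v *)
From mathcomp Require Import all_boot all_order all_algebra.
From mathcomp Require Import complex.
From mathcomp Require Import all_classical all_reals all_analysis.

Set Implicit Arguments.
Unset Strict Implicit.
Unset Printing Implicit Defensive.

Import Order.TTheory GRing.Theory Num.Theory.
Import numFieldNormedType.Exports.

Local Open Scope classical_set_scope.
Local Open Scope ring_scope.

Section LinearAlgebra.
Context {R : realType} {X : lmodType R[i]}.
Implicit Types (A B : set X) (T : X -> X).

Definition indep_mod B (m : nat) (v : 'I_m -> X) : Prop :=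
  forall c : 'I_m -> R[i], B (\sum_(i < m) c i *: v i) -> forall i, c i = 0.

(* Dimension of A / B for linear subspaces B of A, as the supremum of the sizes
   of the families in A whose classes in A / B are linearly independent; all
   infinite cardinals are identified with +oo. *)
Definition quot_dim A B : \bar R :=
  ereal_sup [set (m%:R)%:E | m in [set m : nat |
    exists2 v : 'I_m -> X, (forall i, A (v i)) & indep_mod B v]].

Definition vdim A : \bar R := quot_dim A [set 0].

Definition nullspace T : set X := T @^-1` [set 0].

Definition oppow T (n : nat) : X -> X := iter n T.

Definition shift_op T (mu : R[i]) : X -> X := fun x => T x - mu *: x.

(* The infimum of the empty set is +oo. *)
Definition ascent T : \bar R :=
  ereal_inf [set (n%:R)%:E | n in [set n : nat |
    nullspace (oppow T n) = nullspace (oppow T n.+1)]].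

Definition k_ T (n : nat) : \bar R :=
  quot_dim (range (oppow T n) `&` nullspace T)
           (range (oppow T n.+1) `&` nullspace T).

(* The topology on the scalars is carried by the regular module [R[i]^o]. *)
Definition point_spectrum T : set R[i]^o :=
  [set mu : R[i]^o | exists2 x : X, x != 0 & T x = mu *: x].

End LinearAlgebra.

Section BanachOperators.
Context {R : realType} {X : normedModType R[i]}.
Implicit Types T : X -> X.

(* Norms in [X] are real elements of [R[i]]; [complex.Re] reads them in [R]. *)
Definition oprange_norm T (d : nat) (y : X) : R :=
  inf [set complex.Re `|x| | x in [set x : X | y = oppow T d x]].

(* Closedness of A, a subset of R(T^d), for the metric of [oprange_norm T d] on
   R(T^d): every point of R(T^d) adherent to A lies in A. *)
Definition oprange_closed T (d : nat) (A : set X) : Prop :=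
  forall y : X, range (oppow T d) y ->
    (forall e : R, 0 < e -> exists2 z, A z & oprange_norm T d (y - z) < e) ->
    A y.

Definition TUD T (d : nat) : Prop :=
  (forall n, (d <= n)%N -> k_ T n = 0%E) /\
  (forall n, (d <= n)%N -> oprange_closed T d (range (oppow T n))).

Definition upper_semi_Browder T : Prop :=
  [/\ (vdim (nullspace T) < +oo)%E, closed (range T) & (ascent T < +oo)%E].

Definition left_Drazin_invertible T : Prop :=
  exists2 p : nat, ascent T = (p%:R)%:E & closed (range (oppow T p.+1)).

Definition upper_semi_Browder_spectrum T : set R[i]^o :=
  [set mu : R[i]^o | ~ upper_semi_Browder (shift_op T mu)].

Definition left_Drazin_spectrum T : set R[i]^o :=
  [set mu : R[i]^o | ~ left_Drazin_invertible (shift_op T mu)].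

End BanachOperators.

(* Main.v *)
Require Import Defs.
From HB Require Import structures.
From mathcomp Require Import all_boot all_order all_algebra.
From mathcomp Require Import complex.
From mathcomp Require Import all_classical all_reals all_analysis.
From mathcomp Require Import ring lra.

Set Implicit Arguments.
Unset Strict Implicit.
Unset Printing Implicit Defensive.

Import Order.TTheory GRing.Theory Num.Theory.
Import numFieldNormedType.Exports.

Local Open Scope classical_set_scope.
Local Open Scope ring_scope.

(** Write [S] for [T - lambda].  Everything follows from a dichotomy for [S].

    If [S] is left Drazin invertible with ascent [p], then closedness of
    [R(S^(p+1))] and the open mapping theorem make [S] bounded below on
    [R(S^p)].  This survives a small perturbation [S - mu]; and since [S] acts
    as [mu] modulo [R(S - mu)], any [x] differs from [mu^-p S^p x] by an amount
    controlled by [(S - mu) x].  Hence for small [mu <> 0] the operator [S - mu]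
    is bounded below on all of [X] ([left_Drazin_punctured]): a punctured
    neighbourhood of [lambda] avoids the point spectrum and both other spectra.

    If [S] has uniform descent for [n >= d] but is not left Drazin invertible,
    then [N(S)] meets [R(S^d)] nontrivially ([TUD_left_Drazin]).  Uniform descent
    allows a nonzero vector [z_1] of this intersection to be pulled back forever,
    [S z_(k+1) = z_k], with geometric growth of [z_k] ([nullspace_orbit]).  For
    small [mu] the series [sum_k mu^k z_(k+1)] is then an eigenvector of [S] for
    [mu], and the same summation applied to the orbit of such series inverts
    [S - mu] repeatedly, so [S - mu] has infinite ascent
    ([orbit_infinite_ascent]).  A whole neighbourhood of [lambda] therefore lies
    in all three spectra ([TUD_dichotomy]).

    Each of the first five conditions thus fails in the second case and holds in
    the first one, where the sixth holds as well.

    The tool behind both cases is the open mapping theorem modulo a null space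
    ([open_mapping_mod]): with [G = id] it is the usual theorem for an operator
    with closed range, and with [G = S^d] it is the theorem for the operator
    range topology of [R(S^d)]. *)

(** * The norm as a real-valued function *)

Section RealNorm.
Context {R : realType}.
Implicit Types V W : normedModType R[i].

(** Norms over [R[i]] take values in a partially ordered field; reading them in
    [R] makes the order total, and linear arithmetic applicable. *)
Definition rnorm V (x : V) : R := complex.Re `|x|.

Lemma rnormE V (x : V) : `|x| = (rnorm x)%:C%C.
Proof. by rewrite /rnorm RRe_real // normr_real. Qed.

Lemma rnorm_ge0 V (x : V) : 0 <= rnorm x.
Proof. by have := normr_ge0 x; rewrite rnormE lecR. Qed.

Lemma rnorm0 V : rnorm (0 : V) = 0.
Proof. by rewrite /rnorm normr0. Qed.

Lemma rnorm_le0 V (x : V) : rnorm x <= 0 -> x = 0.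
Proof.
move=> x0; apply: normr0_eq0; rewrite rnormE.
by have /eqP -> : rnorm x == 0 by rewrite eq_le x0 rnorm_ge0.
Qed.

Lemma rnorm_gt0 V (x : V) : x != 0 -> 0 < rnorm x.
Proof. by move=> x0; rewrite ltNge; apply/negP => /rnorm_le0/eqP; apply/negP. Qed.

Lemma rnormD V (x y : V) : rnorm (x + y) <= rnorm x + rnorm y.
Proof. by have := ler_normD x y; rewrite !rnormE -rmorphD lecR. Qed.

Lemma rnormN V (x : V) : rnorm (- x) = rnorm x.
Proof. by rewrite /rnorm normrN. Qed.

Lemma rdistC V (x y : V) : rnorm (x - y) = rnorm (y - x).
Proof. by rewrite -rnormN opprB. Qed.

Lemma rnormB V (x y : V) : rnorm (x - y) <= rnorm x + rnorm y.
Proof. by rewrite -(rnormN y) rnormD. Qed.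

Lemma rdist_triangle V (z x y : V) : rnorm (x - y) <= rnorm (x - z) + rnorm (z - y).
Proof. by have := rnormD (x - z) (z - y); rewrite addrA subrK. Qed.

Lemma rnormZ V (a : R[i]) (x : V) : rnorm (a *: x) = rnorm (a : R[i]^o) * rnorm x.
Proof.
rewrite /rnorm normrZ; have -> : `|x| = (rnorm x)%:C%C by exact: rnormE.
have -> : `|a| = (rnorm (a : R[i]^o))%:C%C by exact: (@rnormE R[i]^o a).
by rewrite -rmorphM.
Qed.

Lemma rnormX (a : R[i]) n : rnorm (a ^+ n : R[i]^o) = rnorm (a : R[i]^o) ^+ n.
Proof.
elim: n => [|n IH]; first by rewrite !expr0 /rnorm normr1.
by rewrite exprS [in RHS]exprS -IH -(@rnormZ R[i]^o).
Qed.

Lemma rnorm_real (t : R) : 0 <= t -> rnorm (t%:C%C : R[i]^o) = t.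
Proof. by move=> t0; rewrite /rnorm ger0_norm // lecR. Qed.

Lemma nbhs_rnormP V (x : V) (U : set V) :
  nbhs x U <-> exists2 e : R, 0 < e & forall y, rnorm (y - x) < e -> U y.
Proof.
split=> [/nbhs_ballP[e e0 eU]|[e e0 eU]].
- exists (complex.Re e); first by move: e0; rewrite /= ltcE /= => /andP[].
  move=> y yx; apply: eU; rewrite -ball_normE /= distrC rnormE.
  move: e0; rewrite /= ltcE => /andP[/eqP /= e0 _].
  by rewrite ltcE /= e0 eqxx.
- apply/nbhs_ballP; exists e%:C%C; first by rewrite /= ltcR.
  by move=> y; rewrite -ball_normE /= distrC rnormE ltcR; exact: eU.
Qed.

Lemma closed_rnormP V (A : set V) :
  closed A <-> forall y, (forall e : R, 0 < e -> exists2 z, A z & rnorm (y - z) < e) -> A y.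
Proof.
split=> [cA y yA|cA y yA].
- apply: cA => U /nbhs_rnormP[e e0 eU].
  by have [z Az yz] := yA e e0; exists z; split=> //; apply: eU; rewrite rdistC.
- apply: cA => e e0.
  have [z [Az yz]] : A `&` [set z | rnorm (z - y) < e] !=set0.
    by apply: yA; apply/nbhs_rnormP; exists e.
  by exists z => //; rewrite rdistC.
Qed.

Lemma halving_le0 (a : R) (e : nat -> R) :
  (forall n, e n.+1 <= e n / 2) -> (forall n, a <= e n) -> a <= 0.
Proof.
move=> eh ae; rewrite leNgt; apply/negP => a0.
have bern n : a * (n.+1)%:R <= e 0%N.
  suff : a * n.+1%:R <= 2 ^- n * e 0%N * n.+1%:R /\ 2 ^- n * e 0%N * n.+1%:R <= e 0%N.
    by case; exact: le_trans.
  have e0 : 0 <= e 0%N by rewrite (le_trans (ltW a0)).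
  have en : e n <= 2 ^- n * e 0%N.
    elim: n => [|n IH]; first by rewrite expr0 invr1 mul1r.
    rewrite exprS invfM; have := eh n; nra.
  split; first by rewrite ler_pM2r ?ltr0n //; exact: le_trans en.
  rewrite mulrAC ler_piMl // ler_pdivrMl ?exprn_gt0 // mulr1.
  by rewrite -natrX ler_nat ltn_expl.
have [n] : exists n : nat, e 0%N / a < n%:R.
  by exists (Num.bound (e 0%N / a)); rewrite archi_boundP // divr_ge0 ?ltW // (lt_le_trans a0).
rewrite ltr_pdivrMr // => h; have := bern n; rewrite -natr1; nra.
Qed.

(** A step bounded by [e n / 2] is at most [e n - e n.+1], so the steps telescope
    and the same [e] bounds the distance to the limit from every index. *)
Lemma halving_cvg (V : completeNormedModType R[i]) (u : nat -> V) (e : nat -> R) :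
  (forall n, e n.+1 <= e n / 2) -> (forall n, rnorm (u n.+1 - u n) <= e n / 2) ->
  exists l, forall n, rnorm (l - u n) <= e n.
Proof.
move=> eh ue.
have e_ge0 n : 0 <= e n by have := ue n; have := rnorm_ge0 (u n.+1 - u n); lra.
have tele n k : rnorm (u (n + k)%N - u n) <= e n - e (n + k)%N.
  elim: k => [|k IH]; first by rewrite addn0 !subrr rnorm0.
  rewrite addnS; have := rdist_triangle (u (n + k)%N) (u (n + k).+1) (u n).
  have := ue (n + k)%N; have := eh (n + k)%N; lra.
have small (d : R) : 0 < d -> exists n, e n < d.
  move=> d0; apply: contrapT => /forallNP h.
  have : d <= 0 by apply: (halving_le0 eh) => n; rewrite leNgt; apply/negP.
  by rewrite leNgt d0.
have cu : cauchy (u @ \oo).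
  apply/cauchy_exP => d /= d0; have dE : d = (complex.Re d)%:C%C.
    by rewrite RRe_real // gtr0_real.
  have [n nd] : exists n, e n < complex.Re d by apply: small; move: d0; rewrite dE ltcR.
  exists (u n); exists n => // m /= nm; rewrite -ball_normE /= distrC rnormE dE ltcR.
  rewrite (le_lt_trans _ nd) // -(subnKC nm) (le_trans (tele _ _)) //.
  by rewrite lerBlDr lerDl.
have := cauchy_cvg _ cu; set l := lim _ => ul; exists l => n; rewrite leNgt; apply/negP => h.
have /ul[N _ HN] : nbhs l [set y | rnorm (y - l) < rnorm (l - u n) - e n].
  by apply/nbhs_rnormP; exists (rnorm (l - u n) - e n); rewrite ?subr_gt0.
have := HN (n + N)%N (leq_addl _ _) => /=.
have := rdist_triangle (u (n + N)%N) l (u n).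
rewrite (rdistC l (u (n + N)%N)); have := tele n N; have := e_ge0 (n + N)%N; lra.
Qed.

End RealNorm.

(** * Baire category and the open mapping theorem *)

(** Choice sequences whose steps exist only under an invariant [P]. *)
Lemma guarded_dependent_choice (T : Type) (P : T -> Prop) (Q : nat -> T -> T -> Prop) (x0 : T) :
  P x0 -> (forall n x, P x -> exists2 y, P y & Q n x y) ->
  exists u : nat -> T, [/\ u 0%N = x0, forall n, P (u n) & forall n, Q n (u n) (u n.+1)].
Proof.
move=> Px0 step.
have /choice[f fP] : forall nx : nat * T, exists y, P nx.2 -> P y /\ Q nx.1 nx.2 y.
  move=> [n x]; have [Px|nPx] := pselect (P x); last by exists x.
  by have [y Py Qy] := step n x Px; exists y.
pose u := fix u n := if n is m.+1 then f (m, u m) else x0.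
have Pu n : P (u n) by elim: n => // n IH; have [] := fP (n, u n) IH.
by exists u; split=> // n; have [] := fP (n, u n) (Pu n).
Qed.

Section OpenMapping.
Context {R : realType}.

Definition rbounded (V W : normedModType R[i]) (T : V -> W) : Prop :=
  exists2 M : R, 0 <= M & forall x, rnorm (T x) <= M * rnorm x.

(** Baire's theorem relative to a closed subset [W].  If no [A n] were dense in
    a ball of [W], nested balls of halving radii, the [n]-th one missing [A n],
    would shrink to a point of [W] outside every [A n]. *)
Lemma baire_closed (Y : completeNormedModType R[i]) (W : set Y) (A : nat -> set Y) :
  closed W -> W !=set0 -> W `<=` \bigcup_n A n ->
  exists n w0, W w0 /\ exists2 r : R, 0 < r & forall w, W w -> rnorm (w - w0) < r ->
    forall e : R, 0 < e -> exists2 a, A n a & rnorm (w - a) < e.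
Proof.
move=> cW [w00 Ww00] WA; apply: contrapT => noball.
pose P (q : Y * R) := W q.1 /\ 0 < q.2.
pose Q n (q q' : Y * R) := [/\ rnorm (q'.1 - q.1) <= q.2 / 2, q'.2 <= q.2 / 2 &
  forall a, A n a -> q'.2 < rnorm (q'.1 - a)].
have P0 : P (w00, 1) by split=> //=.
have [|u [_ Pu Qu]] := guarded_dependent_choice (Q := Q) P0.
  move=> n [w0 r] [/= Ww0 r0]; apply: contrapT => stuck.
  apply: noball; exists n, w0; split=> //; exists (r / 2); first lra.
  move=> w Ww ww0 e e0; apply: contrapT => far; apply: stuck.
  (* [e / 2] rather than [e]: the limit of the balls may lie on the boundary. *)
  exists (w, Num.min (r / 2) (e / 2)); first by split=> //=; rewrite lt_min; apply/andP; split; lra.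
  split=> /=; [exact: ltW|by rewrite ge_min lexx|].
  move=> a Aa; rewrite gt_min; apply/orP; right; rewrite ltNge; apply/negP => h.
  by apply: far; exists a => //; lra.
have [n|n|l lu] := @halving_cvg _ _ (fun n => (u n).1) (fun n => (u n).2).
- by have [] := Qu n.
- by have [] := Qu n.
have Wl : W l.
  move/closed_rnormP: cW; apply => e e0; apply: contrapT => far.
  have : e <= 0.
    apply: (@halving_le0 _ _ (fun n => (u n).2)) => n; first by have [] := Qu n.
    rewrite (le_trans _ (lu n)) // leNgt; apply/negP => h.
    by apply: far; exists (u n).1 => //; have [] := Pu n.
  by rewrite leNgt e0.
have [n _ Anl] := WA l Wl; have [_ _ /(_ _ Anl)] := Qu n.
by rewrite rdistC ltNge lu.
Qed.

(** The quotient [Y / N(G)] is never formed: equality in it is equality of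
    values of [G].  The set assumed closed is [R(F) + N(G)].  By Baire, one of
    the images of balls is dense in a ball of this set, hence, by symmetry and
    convexity, in a ball around 0; so every [w] has an approximate preimage of
    controlled norm with error at most half of [w], and correcting the error
    again and again yields an exact one. *)
Lemma open_mapping_mod (X Y : completeNormedModType R[i]) (Z : normedModType R[i])
    (F : {linear X -> Y}) (G : {linear Y -> Z}) :
  rbounded F -> rbounded G -> closed [set w | exists x, G w = G (F x)] ->
  exists2 C : R, 0 <= C & forall w x, G w = G (F x) ->
    exists2 x', G w = G (F x') & rnorm x' <= C * rnorm w.
Proof.
move=> [MF MF0 bF] [MG MG0 bG]; set W := [set w | _] => cW.
pose A n : set Y := [set w | exists2 x, G w = G (F x) & rnorm x <= n%:R].
have [||n [w0 [Ww0 [r r0 dense]]]] := @baire_closed Y W A cW.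
- by exists 0, 0; rewrite !linear0.
- move=> w [x Gwx]; exists (Num.bound (rnorm x)) => //.
  by exists x => //; rewrite ltW // archi_boundP ?rnorm_ge0.
have WD w w' : W w -> W w' -> W (w + w').
  by move=> [x wx] [x' wx']; exists (x + x'); rewrite !linearD wx wx'.
have WB w w' : W w -> W w' -> W (w - w').
  by move=> [x wx] [x' wx']; exists (x - x'); rewrite !linearB wx wx'.
have WZ (t : R[i]) w : W w -> W (t *: w).
  by move=> [x wx]; exists (t *: x); rewrite !linearZ wx.
have near0 w : W w -> rnorm w < r -> forall e : R, 0 < e ->
    exists a x, [/\ G a = G (F x), rnorm x <= 2 * n%:R & rnorm (w - a) < e].
  move=> Ww wr e e0; have e20 : 0 < e / 2 by lra.
  have [|a1 [x1 Ga1 nx1] wa1] := dense (w + w0) (WD _ _ Ww Ww0) _ _ e20.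
    by rewrite addrK.
  have [|a2 [x2 Ga2 nx2] wa2] := dense w0 Ww0 _ _ e20; first by rewrite subrr rnorm0.
  exists (a1 - a2), (x1 - x2); split; first by rewrite !linearB Ga1 Ga2.
    by have := rnormB x1 x2; lra.
  have -> : w - (a1 - a2) = (w + w0 - a1) - (w0 - a2).
    rewrite (addrAC w) -(addrA (w - a1)) (opprB w0) (addrC w0) subrK.
    by rewrite (opprB a1) (addrC a2) addrA.
  by have := rnormB (w + w0 - a1) (w0 - a2); lra.
pose C := 4 * n%:R / r.
have C0 : 0 <= C by apply: divr_ge0; [rewrite mulr_ge0|exact: ltW].
have halve w : W w -> exists a x, [/\ G a = G (F x), rnorm x <= C * rnorm w &
    rnorm (w - a) <= rnorm w / 2].
  move=> Ww; have [->|/rnorm_gt0 w_gt0] := eqVneq w 0.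
    by exists 0, 0; split; rewrite ?subrr ?rnorm0 ?mulr0 ?mul0r // !linear0.
  pose t := r / (2 * rnorm w).
  have t0 : 0 < t by rewrite divr_gt0 // mulr_gt0.
  have tw : t * rnorm w = r / 2 by rewrite /t; field; rewrite gt_eqF.
  have r40 : 0 < r / 4 by lra.
  have [|a [x [Ga nx wa]]] := near0 (t%:C%C *: w) (WZ _ _ Ww) _ _ r40.
    by rewrite rnormZ rnorm_real ?ltW //; lra.
  have ti : 0 <= t^-1 by rewrite invr_ge0 ltW.
  exists ((t^-1)%:C%C *: a), ((t^-1)%:C%C *: x); split; first by rewrite !linearZ Ga.
    rewrite rnormZ rnorm_real // ler_pdivrMl // mulrCA tw /C.
    by have -> : 4 * n%:R / r * (r / 2) = 2 * n%:R by field; rewrite gt_eqF.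
  have -> : w - (t^-1)%:C%C *: a = (t^-1)%:C%C *: (t%:C%C *: w - a).
    by rewrite scalerBr scalerA -rmorphM mulVf ?gt_eqF // scale1r.
  by rewrite rnormZ rnorm_real // ler_pdivrMl //; lra.
exists (2 * C); first by rewrite mulr_ge0.
move=> w0' x0' Gw0.
(* A state [(w, x)] of the correction process: [x] is the preimage found so
   far and [w] the error left. *)
pose P (q : Y * X) := W q.1 /\ G w0' = G (q.1 + F q.2).
pose Q (_ : nat) (q q' : Y * X) :=
  rnorm q'.1 <= rnorm q.1 / 2 /\ rnorm (q'.2 - q.2) <= C * rnorm q.1.
have P0 : P (w0', 0) by split; [exists x0'|rewrite /= linear0 addr0].
have [|u [u0 Pu Qu]] := guarded_dependent_choice (Q := Q) P0.
  move=> k [w x] [/= Ww Gw]; have [a [x' [Ga nx' wa]]] := halve w Ww.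
  exists (w - a, x + x'); last by split=> //=; rewrite addrAC subrr add0r.
  split=> /=; first by apply: WB => //; exists x'.
  have -> : w - a + F (x + x') = (w + F x) + (F x' - a).
    by rewrite linearD addrACA (addrC (- a)).
  by rewrite linearD linearB Ga subrr addr0.
have [n'|n'|x xu] := @halving_cvg _ _ (fun n => (u n).2) (fun n => 2 * C * rnorm (u n).1).
- by have [h _] := Qu n'; have := ler_wpM2l C0 h; lra.
- by have [_ h] := Qu n'; lra.
exists x; last by have := xu 0%N; rewrite u0 /= subr0.
apply/eqP; rewrite -subr_eq0; apply/eqP/rnorm_le0.
apply: (@halving_le0 _ _ (fun n => MG * (1 + MF * (2 * C)) * rnorm (u n).1)) => n'.
  have [h _] := Qu n'; rewrite -[leRHS]mulrA ler_wpM2l //.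
  by rewrite mulr_ge0 // addr_ge0 // mulr_ge0 // mulr_ge0.
have [_ ->] := Pu n'; rewrite -linearB (le_trans (bG _)) // -mulrA ler_wpM2l //.
rewrite -addrA -linearB (le_trans (rnormD _ _)) // mulrDl mul1r lerD2l.
by rewrite (le_trans (bF _)) // -mulrA ler_wpM2l // rdistC.
Qed.

End OpenMapping.

(** * Powers and ascent *)

Section OperatorPowers.
Context {R : realType} {X : lmodType R[i]}.
Implicit Type S : {linear X -> X}.

Lemma oppow_is_linear S n : linear (oppow S n).
Proof. by elim: n => [|n IH] a x y //=; rewrite IH linearP. Qed.

HB.instance Definition _ S n :=
  GRing.isLinear.Build R[i] X X *:%R (oppow S n) (oppow_is_linear S n).

Lemma shift_op_is_linear S mu : linear (shift_op S mu).
Proof.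
move=> a x y; rewrite /shift_op linearP scalerDr scalerBr !scalerA opprD addrACA.
by rewrite mulrC.
Qed.

HB.instance Definition _ S mu :=
  GRing.isLinear.Build R[i] X X *:%R (shift_op S mu) (shift_op_is_linear S mu).

Lemma oppowS S n x : oppow S n.+1 x = S (oppow S n x).
Proof. exact: iterS. Qed.

Lemma oppowSr S n x : oppow S n.+1 x = oppow S n (S x).
Proof. exact: iterSr. Qed.

Lemma oppowD S m n x : oppow S (m + n) x = oppow S m (oppow S n x).
Proof. exact: iterD. Qed.

Lemma nullspace_stab S n m x : nullspace (oppow S n) = nullspace (oppow S n.+1) ->
  (n <= m)%N -> oppow S m x = 0 -> oppow S n x = 0.
Proof.
move=> stab /subnKC <-; elim: (m - n)%N => [|k IH]; first by rewrite addn0.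
rewrite addnS -addSn oppowD => Sx; apply: IH; rewrite oppowD.
by have : nullspace (oppow S n.+1) (oppow S k x) by []; rewrite -stab.
Qed.

Lemma ascent_lty S : (ascent S < +oo)%E <->
  exists n, nullspace (oppow S n) = nullspace (oppow S n.+1).
Proof.
split=> [|[n stab]]; last first.
  by rewrite (le_lt_trans _ (ltry n%:R)) //; apply: ereal_inf_lbound; exists n.
by move=> /ereal_inf_lt[_ [n stab _] _]; exists n.
Qed.

Lemma ascent_nat S : (ascent S < +oo)%E -> exists p : nat, ascent S = (p%:R)%:E.
Proof.
move=> /ascent_lty ex; have ex' : exists n,
    `[< nullspace (oppow S n) = nullspace (oppow S n.+1) >].
  by have [n h] := ex; exists n; apply/asboolP.
case: (ex_minnP ex') => p /asboolP stab pmin; exists p.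
apply/eqP; rewrite eq_le; apply/andP; split.
  by apply: ereal_inf_lbound; exists p.
by apply: le_ereal_inf_tmp => _ [n h <-]; rewrite lee_fin ler_nat; apply/pmin/asboolP.
Qed.

Lemma ascent_stab S p : ascent S = (p%:R)%:E ->
  nullspace (oppow S p) = nullspace (oppow S p.+1).
Proof.
move=> aS; have : (ascent S < p.+1%:R%:E)%E by rewrite aS lte_fin ltr_nat.
move=> /ereal_inf_lt[_ [n stab <-]]; rewrite lte_fin ltr_nat ltnS => np.
apply/seteqP; split=> x /= h; first by have := congr1 S h; rewrite linear0.
have Snx := nullspace_stab stab (leqW np) h.
by change (oppow S p x = 0); rewrite -(subnK np) oppowD Snx linear0.
Qed.

End OperatorPowers.

(** * Backward orbits and eigenvectors *)

Section BoundedOperators.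
Context {R : realType}.

Lemma rbounded_oppow (X : normedModType R[i]) (S : {linear X -> X}) n :
  rbounded S -> rbounded (oppow S n).
Proof.
move=> [M M0 bS]; elim: n => [|n [K K0 bn]]; first by exists 1 => // x; rewrite mul1r.
exists (M * K); first exact: mulr_ge0.
by move=> x; rewrite oppowS (le_trans (bS _)) // -mulrA ler_wpM2l.
Qed.

Lemma rbounded_shift (X : normedModType R[i]) (S : {linear X -> X}) mu :
  rbounded S -> rbounded (shift_op S mu).
Proof.
move=> [M M0 bS]; exists (M + rnorm (mu : R[i]^o)); first by rewrite addr_ge0 ?rnorm_ge0.
by move=> x; rewrite (le_trans (rnormB _ _)) // rnormZ mulrDl lerD2r.
Qed.

Definition backward_orbit (X : normedModType R[i]) (S : X -> X) (A C : R) (z : nat -> X) :=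
  (forall k, S (z k.+1) = z k) /\ forall k, rnorm (z k) <= A * C ^+ k.

Context {X : completeNormedModType R[i]} (S : {linear X -> X}).

(** The series [z' k = sum_j mu^j z (j + k.+1)] is a right inverse of [S - mu]
    along the orbit: it satisfies [z' k = z k.+1 + mu z' k.+1], and applying [S]
    gives [S (z' k) = z k + mu z' k].  Its values form an orbit of the same
    growth, so that the construction can be iterated. *)
Lemma resolvent_orbit (A C : R) (mu : R[i]) z : rbounded S -> 0 <= A -> 0 <= C ->
  rnorm (mu : R[i]^o) * C <= 1 / 2 -> backward_orbit S A C z ->
  exists2 z', backward_orbit S (2 * A * C) C z' & forall k, shift_op S mu (z' k) = z k.
Proof.
move=> [M M0 bS] A0 C0; set m := rnorm _ => mC [Sz zA].
have m0 : 0 <= m by exact: rnorm_ge0.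
pose u k n := \sum_(j < n) mu ^+ j *: z (j + k.+1)%N.
pose e k (n : nat) : R := 2 * A * C ^+ k.+1 / 2 ^+ n.
have eh k n : e k n.+1 <= e k n / 2 by rewrite /e [2 ^+ n.+1]exprS invfM; lra.
have ue k n : rnorm (u k n.+1 - u k n) <= e k n / 2.
  rewrite /u big_ord_recr /= addrAC subrr add0r rnormZ rnormX -/m.
  apply: (@le_trans _ _ (m ^+ n * (A * C ^+ (n + k.+1)))).
    by rewrite ler_wpM2l ?exprn_ge0.
  have -> : m ^+ n * (A * C ^+ (n + k.+1)) = A * C ^+ k.+1 * (m * C) ^+ n.
    by rewrite exprD exprMn; ring.
  have -> : e k n / 2 = A * C ^+ k.+1 * (1 / 2) ^+ n.
    by rewrite /e expr_div_n expr1n; field; rewrite expf_neq0.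
  by rewrite ler_wpM2l ?mulr_ge0 ?exprn_ge0 // lerXn2r // nnegrE ?mulr_ge0.
have /choice[z' z'u] : forall k, exists l, forall n, rnorm (l - u k n) <= e k n.
  by move=> k; apply: halving_cvg.
have Sz' k : S (z' k.+1) = z' k.
  apply/eqP; rewrite -subr_eq0; apply/eqP/rnorm_le0.
  apply: (@halving_le0 _ _ (fun n => M * e k.+1 n + e k n)) => n.
    by have := eh k n; have := ler_wpM2l M0 (eh k.+1 n); lra.
  have Su : S (u k.+1 n) = u k n.
    rewrite linear_sum; apply: eq_bigr => j _.
    by rewrite linearZ /= addnS Sz.
  rewrite (le_trans (rdist_triangle (u k n) _ _)) // (rdistC _ (z' k)) lerD //.
  by rewrite -Su -linearB (le_trans (bS _)) // ler_wpM2l.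
have z'rec k : z' k = z k.+1 + mu *: z' k.+1.
  apply/eqP; rewrite -subr_eq0; apply/eqP/rnorm_le0.
  apply: (@halving_le0 _ _ (fun n => e k n.+1 + m * e k.+1 n)) => n.
    by have := eh k n.+1; have := ler_wpM2l m0 (eh k.+1 n); lra.
  have uS : u k n.+1 = z k.+1 + mu *: u k.+1 n.
    rewrite /u big_ord_recl expr0 scale1r add0n scaler_sumr; congr (_ + _).
    by apply: eq_bigr => j _; rewrite scalerA -exprS lift0 addSnnS.
  rewrite (le_trans (rdist_triangle (u k n.+1) _ _)) // lerD //.
  rewrite uS opprD addrACA subrr add0r -scalerBr rnormZ ler_wpM2l //.
  by rewrite rdistC.
exists z'; last first.
  move=> k; rewrite /shift_op {1}z'rec linearD linearZ /= Sz Sz'.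
  by rewrite addrK.
split=> // k; have := z'u k 0%N; rewrite /u big_ord0 subr0 /e expr0 divr1 exprS.
by rewrite mulrA.
Qed.

Lemma oppow_shift_orbit (A C : R) (mu : R[i]) n z : rbounded S -> 0 <= A -> 0 <= C ->
  rnorm (mu : R[i]^o) * C <= 1 / 2 -> backward_orbit S A C z ->
  exists x, oppow (shift_op S mu) n x = z 0%N.
Proof.
move=> bS A0 C0 mC; elim: n A A0 z => [|n IH] A A0 z oz; first by exists (z 0%N).
have [z' oz' z'z] := resolvent_orbit bS A0 C0 mC oz.
have [|x xz'] := IH (2 * A * C) _ z' oz'; first by rewrite !mulr_ge0.
by exists x; rewrite oppowS xz'; exact: z'z.
Qed.

(** When [z 0 = 0], the orbit [z'] of [resolvent_orbit] starts at a solution of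
    [(S - mu) x = 0], which is close to [z 1] and so nonzero.  Being itself the
    start of an orbit, it lies in the range of every power of [S - mu], which is
    why no power stops enlarging the null space.  The case [mu = 0] is
    included. *)
Lemma orbit_infinite_ascent (A C : R) (mu : R[i]) z : rbounded S -> 0 <= A -> 0 <= C ->
  backward_orbit S A C z -> z 0%N = 0 ->
  rnorm (mu : R[i]^o) * C <= 1 / 2 ->
  rnorm (mu : R[i]^o) * (2 * A * C * C) < rnorm (z 1%N) ->
  (exists2 x, x != 0 & S x = mu *: x) /\
  forall n, nullspace (oppow (shift_op S mu) n) <> nullspace (oppow (shift_op S mu) n.+1).
Proof.
move=> bS A0 C0 oz z0 mC muz.
have [z' oz' z'z] := resolvent_orbit bS A0 C0 mC oz.
have z'0_neq0 : z' 0%N != 0.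
  apply/eqP => z'00; move: muz; rewrite ltNge => /negP; apply.
  have [Sz' bz'] := oz'.
  have <- : rnorm (mu *: z' 1%N) = rnorm (z 1%N).
    by rewrite -rnormN -(z'z 1%N) /shift_op Sz' z'00 sub0r.
  by rewrite rnormZ ler_wpM2l ?rnorm_ge0 // (le_trans (bz' _)) // expr1.
have eig : shift_op S mu (z' 0%N) = 0 by rewrite z'z z0.
split; first by exists (z' 0%N) => //; apply/eqP; rewrite -subr_eq0; apply/eqP.
move=> n stab; have A'0 : 0 <= 2 * A * C by rewrite !mulr_ge0.
have [x xz'] := oppow_shift_orbit n bS A'0 C0 mC oz'.
have : nullspace (oppow (shift_op S mu) n.+1) x.
  by change (oppow (shift_op S mu) n.+1 x = 0); rewrite oppowS xz'; exact: eig.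
by rewrite -stab /nullspace /= xz' => /eqP; apply/negP.
Qed.

(** Inside [R(S^d)], the null space of every power of [S] is contained in
    [R(S^(d+1))], because [N(S)] meets all ranges [R(S^n)], [n >= d], in the same
    set.  So pulling back along [S] never stops, and the open mapping theorem
    modulo [N(S^d)] bounds each step.  The orbit is [z (k+1) = S^d (u k)], where
    the vectors [u k] carry the growth estimate: it is their norm, the operator
    range norm of [z], that the lifting controls. *)
Lemma nullspace_orbit d x0 : rbounded S ->
  (forall n x, (d <= n)%N -> S (oppow S n x) = 0 ->
    exists y, oppow S n x = oppow S n.+1 y) ->
  closed [set w | exists x, oppow S d w = oppow S d (S x)] ->
  S (oppow S d x0) = 0 ->
  exists z A C, [/\ 0 <= A, 0 <= C, backward_orbit S A C z, z 0%N = 0 & z 1%N = oppow S d x0].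
Proof.
move=> bS hk cW Sx0.
have [C C0 lift] := open_mapping_mod bS (rbounded_oppow d bS) cW.
have ker_range x m : S (oppow S d x) = 0 -> exists y, oppow S d x = oppow S (d + m) y.
  move=> Sx; elim: m => [|m [y xy]]; first by exists x; rewrite addn0.
  have [||y' yy'] := hk (d + m)%N y; first exact: leq_addr.
    by rewrite -xy.
  by exists y'; rewrite xy yy' addnS.
have kern_range j x m : oppow S j (oppow S d x) = 0 ->
    exists y, oppow S d x = oppow S (d + m) y.
  elim: j x m => [|j IH] x m.
    by move=> /= x0'; exists 0; rewrite linear0.
  rewrite oppowSr -oppowS oppowSr => /(IH _ m.+1)[y xy].
  have [|v vE] := ker_range (x - oppow S m y) m.
    by rewrite !linearB /= -oppowD -!oppowS (oppowSr S d) xy addnS subrr.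
  by exists (v + y); rewrite linearD /= -vE linearB /= -oppowD subrK.
pose P u := exists j, oppow S j (oppow S d u) = 0.
pose Q (_ : nat) u u' := oppow S d u = oppow S d (S u') /\ rnorm u' <= C * rnorm u.
have P0 : P x0 by exists 1%N.
have [|u [u0 Pu Qu]] := guarded_dependent_choice (Q := Q) P0.
  move=> k v [j jv]; have [y vy] := kern_range j v 1%N jv.
  have [|v' vv' nv'] := lift v y; first by rewrite /= vy addn1 oppowSr.
  by exists v' => //; exists j.+1; rewrite oppowSr -oppowS oppowSr -[oppow S d (S v')]vv'.
have [K K0 bK] := rbounded_oppow d bS.
have C1 : 0 <= Num.max 1 C by rewrite le_max C0 orbT.
have C11 : 1 <= Num.max 1 C by rewrite le_max lexx.
exists (fun k => if k is k'.+1 then oppow S d (u k') else 0), (K * rnorm x0), (Num.max 1 C).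
have A0 : 0 <= K * rnorm x0 by rewrite mulr_ge0 ?rnorm_ge0.
split=> //; last by rewrite u0.
split=> [[|k]|[|k]]; first by rewrite u0 Sx0.
- by have [-> _] := Qu k; rewrite -oppowS oppowSr.
- by rewrite rnorm0 mulr_ge0 ?exprn_ge0.
rewrite (le_trans (bK _)) // -mulrA ler_wpM2l // mulrC.
apply: (@le_trans _ _ (Num.max 1 C ^+ k * rnorm x0)); last first.
  by rewrite ler_wpM2r ?rnorm_ge0 // exprS ler_peMl ?exprn_ge0.
elim: k => [|k IH]; first by rewrite expr0 mul1r u0.
have [_ h] := Qu k; rewrite (le_trans h) // exprS -mulrA ler_pM ?rnorm_ge0 //.
by rewrite le_max lexx orbT.
Qed.

End BoundedOperators.

(** * Consequences of topological uniform descent *)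

Section UniformDescent.
Context {R : realType}.

Lemma quot_dim_eq0 (X : lmodType R[i]) (A B : set X) :
  (forall (a : R[i]) x, B x -> B (a *: x)) -> quot_dim A B = 0%E -> A `<=` B.
Proof.
move=> BZ AB0 v Av; apply: contrapT => nBv.
have : ((1%:R)%:E <= quot_dim A B)%E.
  apply: ereal_sup_ubound; exists 1%N => //; exists (fun=> v) => // c.
  rewrite big_ord1 => Bcv i; rewrite (ord1 i); apply/eqP/negPn/negP => c0.
  by apply: nBv; rewrite -[v](scalerK c0); exact: BZ.
by rewrite AB0 lee_fin ler10.
Qed.

Lemma k_eq0 (X : lmodType R[i]) (S : {linear X -> X}) n x :
  k_ S n = 0%E -> S (oppow S n x) = 0 -> exists y, oppow S n x = oppow S n.+1 y.
Proof.
move=> /quot_dim_eq0 kB Sx; have [||[y _ <-] _] := kB _ (oppow S n x).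
- move=> a _ [[y _ <-] Ny]; split; first by exists (a *: y) => //; rewrite linearZ.
  by change (S (a *: oppow S n.+1 y) = 0); rewrite linearZ /= [S _]Ny scaler0.
- by split=> //; exists x.
- by exists y.
Qed.

Lemma oprange_norm_le (X : normedModType R[i]) (S : X -> X) d x :
  oprange_norm S d (oppow S d x) <= rnorm x.
Proof.
apply: ge_inf; last by exists x.
by exists 0 => _ [y _ <-]; exact: rnorm_ge0.
Qed.

(** Closedness of [R(S^(d+m))] in the operator range topology pulls back along
    [S^d] to closedness of [R(S^m) + N(S^d)] in [X]. *)
Lemma oprange_closed_preimage (X : normedModType R[i]) (S : {linear X -> X}) d m :
  oprange_closed S d (range (oppow S (d + m))) ->
  closed [set w | exists x, oppow S d w = oppow S d (oppow S m x)].
Proof.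
move=> cS; apply/closed_rnormP => y yW.
have [||x _ yx] := cS (oppow S d y); first by exists y.
  move=> e /yW[z [x zx] yz]; exists (oppow S d z).
    by exists x; rewrite // oppowD zx.
  by rewrite -linearB (le_lt_trans (oprange_norm_le _ _ _)).
by exists x; rewrite -yx oppowD.
Qed.

(** A range with closed sum and trivial intersection with [N(G)] is closed.  If
    [F v] approaches [y], where [y - F x] is in [N(G)], the controlled lift [x']
    of [y - F v] modulo [N(G)] gives [F x' = F (x - v)] by triviality of the
    intersection; hence [y - F x = (y - F v) - F x'] is arbitrarily small. *)
Lemma closed_range_mod (X Y : completeNormedModType R[i]) (Z : normedModType R[i])
    (F : {linear X -> Y}) (G : {linear Y -> Z}) :
  rbounded F -> rbounded G -> closed [set w | exists x, G w = G (F x)] ->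
  (forall x, G (F x) = 0 -> F x = 0) -> closed (range F).
Proof.
move=> bF bG cW inj; have [C C0 lift] := open_mapping_mod bF bG cW.
have [M M0 bM] := bF.
apply/closed_rnormP => y yF.
have [x Gyx] : exists x, G y = G (F x).
  move/closed_rnormP: cW; apply => e /yF[_ [x _ <-] yx].
  by exists (F x) => //; exists x.
exists x => //; apply/eqP; rewrite eq_sym -subr_eq0; apply/eqP/rnorm_le0.
have key (e : R) : 0 < e -> rnorm (y - F x) <= (1 + M * C) * e.
  move=> /yF[_ [v _ <-] yv].
  have [|x' Gx' nx'] := lift (y - F v) (x - v); first by rewrite !linearB /= Gyx.
  have -> : y - F x = (y - F v) - F x'.
    have GvE : G (y - F v) = G (F x) - G (F v) by rewrite linearB /= Gyx.
    have : F (x - v - x') = 0 by apply: inj; rewrite !linearB /= -Gx' GvE subrr.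
    by rewrite !linearB /= => /subr0_eq <-; rewrite opprB addrA subrK.
  rewrite (le_trans (rnormB _ _)) // mulrDl mul1r lerD //; first exact: ltW.
  by rewrite (le_trans (bM _)) // -mulrA ler_wpM2l // (le_trans nx') // ler_wpM2l // ltW.
apply: (@halving_le0 _ _ (fun n => (1 + M * C) * 2 ^- n)) => n; last first.
  by apply: key; rewrite invr_gt0 exprn_gt0.
by rewrite exprS invfM mulrCA mulrC.
Qed.

Context {X : completeNormedModType R[i]} (S : {linear X -> X}).

(** The ascent [p] is at most [d], and [N(S^d) = N(S^p)] meets [R(S^(p+1))]
    trivially, while their sum is closed by uniform descent. *)
Lemma TUD_left_Drazin d : rbounded S -> TUD S d ->
  (forall x, S (oppow S d x) = 0 -> oppow S d x = 0) -> left_Drazin_invertible S.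
Proof.
move=> bS [_ cS] inj.
have stab : nullspace (oppow S d) = nullspace (oppow S d.+1).
  apply/seteqP; split=> x /= h; last by apply: inj; rewrite -oppowS.
  by have := congr1 S h; rewrite linear0.
have [|p ap] := @ascent_nat _ _ S; first by apply/ascent_lty; exists d.
have pd m x : oppow S m x = 0 -> oppow S p x = 0.
  have stabp := ascent_stab ap.
  have [/(nullspace_stab stabp)//|/ltnW mp] := leqP p m; first exact.
  by move=> mx; rewrite -(subnK mp) oppowD mx linear0.
have dm m x : oppow S m x = 0 -> oppow S d x = 0.
  have [/(nullspace_stab stab)//|/ltnW md] := leqP d m; first exact.
  by move=> mx; rewrite -(subnK md) oppowD mx linear0.
exists p => //; apply: (@closed_range_mod _ _ _ (oppow S p.+1) (oppow S d)).
- exact: rbounded_oppow.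
- exact: rbounded_oppow.
- by apply: oprange_closed_preimage; apply: cS; exact: leq_addr.
- move=> x h; have /pd px : oppow S (d + p.+1) x = 0 by rewrite oppowD.
  by have := congr1 S px; rewrite linear0.
Qed.

(** No left Drazin invertibility means a nonzero vector in both [N(S)] and
    [R(S^d)], from which an orbit starts. *)
Lemma TUD_dichotomy d : rbounded S -> TUD S d -> ~ left_Drazin_invertible S ->
  exists2 e : R, 0 < e & forall mu : R[i], rnorm (mu : R[i]^o) < e ->
    (exists2 x, x != 0 & S x = mu *: x) /\ ~ (ascent (shift_op S mu) < +oo)%E.
Proof.
move=> bS TS nLD; have [k0 cS] := TS.
have [x0 [Sx0 x0N]] : exists x, S (oppow S d x) = 0 /\ oppow S d x <> 0.
  apply: contrapT => h; apply: nLD; apply: (TUD_left_Drazin bS TS) => x Sx.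
  by apply: contrapT => Sdx; apply: h; exists x.
have [|||z [A [C [A0 C0 oz z0 z1]]]] := @nullspace_orbit _ _ S d x0 bS.
- by move=> n x dn; apply: k_eq0; exact: k0.
- by apply: (@oprange_closed_preimage _ S d 1%N); apply: cS; exact: leq_addr.
- exact: Sx0.
have z1_gt0 : 0 < rnorm (z 1%N) by rewrite z1 rnorm_gt0 //; apply/eqP.
have AC0 : 0 <= 2 * A * C * C by rewrite !mulr_ge0.
exists (Num.min (1 / (2 * (C + 1))) (rnorm (z 1%N) / (2 * A * C * C + 1))).
  by rewrite lt_min !divr_gt0 // ?mulr_gt0 //; lra.
move=> mu; rewrite lt_min !ltr_pdivlMr; [|lra|lra] => /andP[mu1 mu2].
have mu0 := rnorm_ge0 (mu : R[i]^o).
have [||eig asc] := orbit_infinite_ascent (mu := mu) bS A0 C0 oz z0; [lra|lra|].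
split=> // /ascent_lty[n stab]; exact: asc stab.
Qed.

End UniformDescent.

(** * Left Drazin invertible operators *)

Section LeftDrazin.
Context {R : realType} {X : completeNormedModType R[i]}.
Implicit Type S F : {linear X -> X}.

Lemma closed_range_bounded_below F (K : R) : rbounded F -> 0 <= K ->
  (forall x, rnorm x <= K * rnorm (F x)) -> closed (range F).
Proof.
move=> [M M0 bF] K0 below; apply/closed_rnormP => y yF.
pose h (n : nat) : R := 2 ^- n.
have hS n : h n.+1 = h n / 2 by rewrite /h exprS invfM; lra.
have h0 n : 0 < h n by rewrite /h invr_gt0 exprn_gt0.
have /choice[u uy] : forall n, exists x, rnorm (y - F x) < h n.
  by move=> n; have [_ [x _ <-] yx] := yF _ (h0 n); exists x.
have [n|n|x xu] := @halving_cvg _ _ u (fun n => 4 * K * h n).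
- by rewrite hS; lra.
- rewrite (le_trans (below _)) // linearB.
  have -> : 4 * K * h n / 2 = K * (2 * h n) by lra.
  rewrite ler_wpM2l // (le_trans (rdist_triangle y _ _)) // (rdistC _ y).
  by have := uy n; have := uy n.+1; rewrite hS; have := h0 n; lra.
exists x => //; apply/eqP; rewrite eq_sym -subr_eq0; apply/eqP/rnorm_le0.
apply: (@halving_le0 _ _ (fun n => h n + M * (4 * K * h n))) => n.
  by rewrite hS; lra.
rewrite (le_trans (rdist_triangle (F (u n)) _ _)) // lerD ?(ltW (uy n)) //.
by rewrite -linearB (le_trans (bF _)) // ler_wpM2l // rdistC.
Qed.

(** Lifting [S^(p+1) u] through the open mapping theorem changes [u] by an
    element of [N(S^(p+1)) = N(S^p)], whence a bound for [S^p u] by [S^(p+1) u].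
    For small [mu] this bounds [S^p x] by [(S - mu) x], and
    [mu S^n x = S^(n+1) x - S^n (S - mu) x] passes from [S^p x] to [mu^p x]. *)
Lemma left_Drazin_punctured S : rbounded S -> left_Drazin_invertible S ->
  exists2 e : R, 0 < e & forall mu : R[i], mu != 0 -> rnorm (mu : R[i]^o) < e ->
    (forall x, S x = mu *: x -> x = 0) /\ closed (range (shift_op S mu)).
Proof.
move=> bS [p ap cp].
have cW : closed [set w | exists x, (idfun : {linear X -> X}) w = idfun (oppow S p.+1 x)].
  suff -> : [set w | exists x, w = oppow S p.+1 x] = range (oppow S p.+1) by [].
  by apply/seteqP; split=> [w [x wx]|w [x _ wx]]; exists x.
have bid : rbounded (idfun : {linear X -> X}) by exists 1 => // x; rewrite mul1r.
have [C C0 lift] := open_mapping_mod (rbounded_oppow p.+1 bS) bid cW.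
have [M M0 bM] := rbounded_oppow p bS.
have below u : rnorm (oppow S p u) <= M * C * rnorm (oppow S p.+1 u).
  have [x /= ux nx] := lift (oppow S p.+1 u) u erefl.
  have : nullspace (oppow S p.+1) (u - x).
    change (oppow S p.+1 (u - x) = 0); rewrite linearB; apply/eqP; rewrite subr_eq0.
    by apply/eqP; exact: ux.
  rewrite -(ascent_stab ap) /nullspace /= linearB => /subr0_eq ux'.
  have -> : rnorm (oppow S p u) = rnorm (oppow S p x) by rewrite [oppow S p u]ux'.
  by rewrite (le_trans (bM _)) // -mulrA ler_wpM2l //; exact: nx.
have MC0 : 0 <= M * C by exact: mulr_ge0.
exists (1 / (2 * (M * C + 1))); first by rewrite divr_gt0 //; lra.
move=> mu mu_neq0; rewrite ltr_pdivlMr; last lra.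
have := rnorm_ge0 (mu : R[i]^o); have := rnorm_gt0 (mu_neq0 : (mu : R[i]^o) != 0).
set m := rnorm _ => m_gt0 m0 mC.
have stepE n x : mu *: oppow S n x = oppow S n.+1 x - oppow S n (shift_op S mu x).
  rewrite oppowSr /shift_op linearB linearZ /=.
  by rewrite opprB addrC subrK.
have power_bound n : exists2 Q : R, 0 <= Q & forall x,
    m ^+ n * rnorm x <= rnorm (oppow S n x) + Q * rnorm (shift_op S mu x).
  elim: n => [|n [Q Q0 IH]]; first by exists 0 => // x; rewrite expr0 mul1r mul0r addr0.
  have [K K0 bK] := rbounded_oppow n bS.
  exists (K + m * Q); first by rewrite addr_ge0 ?mulr_ge0.
  move=> x; rewrite exprS -mulrA (le_trans (ler_wpM2l m0 (IH x))) // mulrDr.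
  have : m * rnorm (oppow S n x) <= rnorm (oppow S n.+1 x) + rnorm (oppow S n (shift_op S mu x)).
    by rewrite -rnormZ stepE rnormB.
  by have := bK (shift_op S mu x); lra.
have [Q Q0 pQ] := power_bound p.
have range_bound x : rnorm (oppow S p x) <= 2 * (M * C * M) * rnorm (shift_op S mu x).
  have : rnorm (oppow S p.+1 x) <= m * rnorm (oppow S p x) + M * rnorm (shift_op S mu x).
    have -> : oppow S p.+1 x = mu *: oppow S p x + oppow S p (shift_op S mu x).
      by rewrite stepE subrK.
    by rewrite (le_trans (rnormD _ _)) // rnormZ lerD2l.
  move=> /(ler_wpM2l MC0); have := below x; have := rnorm_ge0 (oppow S p x).
  set a := rnorm (oppow S p x); set b := rnorm (shift_op _ _ _) => a0 ab1 ab2.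
  have : (M * C * m) * a <= 1 / 2 * a by rewrite ler_wpM2r //; lra.
  lra.
pose K := (2 * (M * C * M) + Q) / m ^+ p.
have K0 : 0 <= K by rewrite divr_ge0 ?exprn_ge0 // addr_ge0 ?mulr_ge0.
have bounded_below x : rnorm x <= K * rnorm (shift_op S mu x).
  rewrite /K mulrAC ler_pdivlMr ?exprn_gt0 // mulrC (le_trans (pQ x)) //.
  by rewrite mulrDl lerD2r range_bound.
split=> [x Sx|]; last exact: closed_range_bounded_below (rbounded_shift mu bS) K0 bounded_below.
apply: rnorm_le0; rewrite (le_trans (bounded_below x)) // /shift_op Sx subrr.
by rewrite rnorm0 mulr0.
Qed.

Lemma injective_ascent0 S : (forall x, S x = 0 -> x = 0) -> ascent S = 0%E.
Proof.
move=> inj; apply/eqP; rewrite eq_le; apply/andP; split.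
  apply: ereal_inf_lbound; exists 0%N => //.
  by apply/seteqP; split=> x; [move=> x0; have := congr1 S x0; rewrite linear0|exact: inj].
by apply: le_ereal_inf_tmp => _ [n _ <-]; rewrite lee_fin.
Qed.

(** Such an operator has ascent 0 and trivial null space. *)
Lemma injective_closed_range_Browder S : (forall x, S x = 0 -> x = 0) ->
  closed (range S) -> upper_semi_Browder S /\ left_Drazin_invertible S.
Proof.
move=> inj cS; have aS := injective_ascent0 inj; split; last by exists 0%N.
split=> //; last by rewrite aS ltry.
rewrite (le_lt_trans _ (ltry 0)) //; apply: ge_ereal_sup => _ [m [v Nv vfree] <-].
case: m v Nv vfree => [//|m] v Nv /(_ (fun=> 1)) vfree.
have /vfree/(_ ord0)/eqP : [set 0] (\sum_(i < m.+1) (1 : R[i]) *: v i).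
  by rewrite /= big1 // => i _; rewrite (inj _ (Nv i)) scaler0.
by rewrite oner_eq0.
Qed.

End LeftDrazin.

(** * Spectra near [lambda] *)

Lemma rbounded_bounded_near (R : realType) (X : normedModType R[i]) (T : {linear X -> X}) :
  bounded_near T (nbhs (0 : X)) -> rbounded T.
Proof.
move=> /linear_boundedP/pinfty_ex_gt0[M M0 bM].
have ME : M = (complex.Re M)%:C%C by rewrite RRe_real // gtr0_real.
exists (complex.Re M); first by move: M0; rewrite ME ltcR => /ltW.
by move=> x; have := bM x; rewrite !rnormE ME -rmorphM lecR.
Qed.

Lemma shift_opD (R : realType) (X : lmodType R[i]) (T : X -> X) (lambda mu : R[i]) :
  shift_op (shift_op T lambda) (mu - lambda) = shift_op T mu.
Proof.
by apply/funext => x; rewrite /shift_op scalerBl opprB addrA subrK.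
Qed.

Lemma interior_limit_point (R : realType) (E : set R[i]^o) (lambda : R[i]^o) :
  interior E lambda -> limit_point E lambda.
Proof.
move=> /nbhs_rnormP[e e0 eE] U /nbhs_rnormP[r r0 rU].
pose t : R := Num.min e r / 2.
have t0 : 0 < t by rewrite divr_gt0 // lt_min e0.
have te : t < e /\ t < r.
  by move: t0; rewrite /t; have := lexx (Num.min e r); rewrite le_min => /andP[]; lra.
have tn : rnorm (lambda + t%:C%C - lambda : R[i]^o) = t.
  by rewrite addrAC subrr add0r rnorm_real // ltW.
exists (lambda + t%:C%C); split; [|apply: eE|apply: rU]; rewrite ?tn; [|lra|lra].
apply/eqP => h; move: tn; rewrite h subrr rnorm0 => t00.
by move: t0; rewrite -t00 ltxx.
Qed.

Theorem theorem2p14 (R : realType) (X : completeNormedModType R[i])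
  (infinite_dim : vdim [set: X] = +oo%E)
  (lambda : R[i]^o) (T : {linear X -> X})
  (T_bounded : bounded_near T (nbhs (0 : X)))
  (d : nat) (T_TUD : TUD (shift_op T lambda) d) :
  [<-> ~ interior (point_spectrum T) lambda;
       ~ limit_point (upper_semi_Browder_spectrum T) lambda;
       ~ interior (upper_semi_Browder_spectrum T) lambda;
       ~ limit_point (left_Drazin_spectrum T) lambda;
       ~ interior (left_Drazin_spectrum T) lambda;
       left_Drazin_invertible (shift_op T lambda)].
Proof.
pose S : {linear X -> X} := shift_op T lambda.
have bS : rbounded S by exact: rbounded_shift (rbounded_bounded_near T_bounded).
have SE mu x : S x = (mu - lambda) *: x <-> T x = mu *: x.
  by rewrite /S /= /shift_op scalerBl; split=> [/addIr|->].
have nLD_interior : ~ left_Drazin_invertible S ->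
    [/\ interior (point_spectrum T) lambda, interior (upper_semi_Browder_spectrum T) lambda
      & interior (left_Drazin_spectrum T) lambda].
  move=> /(TUD_dichotomy bS T_TUD)[e e0 He].
  split; apply/nbhs_rnormP; exists e => // mu /He[[x x0 Sx]]; rewrite shift_opD => asc.
  - by exists x => //; apply/SE.
  - by move=> [].
  - by move=> [p ap _]; apply: asc; rewrite ap ltry.
have LD_isolated : left_Drazin_invertible S ->
    [/\ ~ limit_point (point_spectrum T) lambda,
        ~ limit_point (upper_semi_Browder_spectrum T) lambda
      & ~ limit_point (left_Drazin_spectrum T) lambda].
  move=> /(left_Drazin_punctured bS)[e e0 He].
  pose U : set R[i]^o := [set mu : R[i]^o | rnorm (mu - lambda) < e].
  have nU : nbhs lambda U by apply/nbhs_rnormP; exists e.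
  have good (mu : R[i]^o) : mu != lambda -> U mu ->
      [/\ ~ point_spectrum T mu, upper_semi_Browder (shift_op T mu)
        & left_Drazin_invertible (shift_op T mu)].
    move=> ml Umu; have [|inj cr] := He (mu - lambda) _ Umu; first by rewrite subr_eq0.
    have [||usb ld] := @injective_closed_range_Browder _ _ (shift_op T mu).
    - by move=> x /subr0_eq/SE; exact: inj.
    - by have -> : range (shift_op T mu) = range (shift_op S (mu - lambda)) by rewrite shift_opD.
    by split=> // -[x x0 /SE/inj/eqP]; apply/negP.
  by split=> /(_ U nU)[mu [ml Emu Umu]]; have [] := good mu ml Umu.
have LD_of (P : Prop) : (~ left_Drazin_invertible S -> P) -> ~ P -> left_Drazin_invertible S.
  by move=> h nP; apply: contrapT => /h.
split.
- by move=> h; have [|_ h2 _] := LD_isolated; first by apply: LD_of h => /nLD_interior[].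
split; first by move=> h /interior_limit_point.
split.
- by move=> h; have [|_ _ h2] := LD_isolated; first by apply: LD_of h => /nLD_interior[].
split; first by move=> h /interior_limit_point.
split; first by move=> h; apply: LD_of h => /nLD_interior[].
by move=> /LD_isolated[h _ _] /interior_limit_point.
Qed.
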